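(* Suppose a biclique $[A,B]$ is partitioned into $r$ bi-equivalence graphs and no two vertices of $A$ are equivalent. Then $\max\{|A|,|B|\}\le r!$, and equality is possible.
   Context: A biclique $[A,B]$ is a complete bipartite graph with nonempty vertex classes $A$ and $B$. A bi-equivalence graph is a graph each of whose connected components is a biclique (with both vertex classes nonempty); the two vertex classes of a component are called its blocks. A partition of $[A,B]$ into bi-equivalence graphs $G_1,\dots,G_r$ means that every edge of $[A,B]$ belongs to exactly one $G_i$; a vertex need not be incident with an edge of every $G_i$. Two vertices $u,v$ in the same class ($u,v\in A$ or $u,v\in B$) are equivalent if they belong to the same block in every bi-equivalence graph of the partition, in the sense that for every vertex $w$ of the opposite class the edges $uw$ and $vw$ belong to the same $G_i$ (so for each $i$, either $u$ and $v$ lie in the same block of $G_i$ or neither is incident with an edge of $G_i$).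
   Formalization: As stated, |B| ≤ r! fails (A = {a}, B = {b,b'}, r = 1, G_1 = [A,B]); the bound on max{|A|,|B|} also assumes that no two vertices of B are equivalent, while |A| ≤ r! is proved under the stated hypothesis alone. *)

(* Defs.v *)
From mathcomp Require Import all_boot.
Set Implicit Arguments.
Unset Strict Implicit.
Unset Printing Implicit Defensive.

(* The vertex set is carried separately from the ambient type: a subgraph of
   [A, B] need not contain every vertex of [A, B], and whether a graph has
   isolated vertices matters for [bi_equivalence]. *)
Record sgraph (V : finType) := SGraph {
  vset : {set V};
  edge : rel V;
  edge_sym : symmetric edge;
  edge_irr : irreflexive edge;
  edge_vset : forall x y, edge x y -> x \in vset }.

Section Graphs.
Variable V : finType.
Implicit Types (G K : sgraph V) (A B S : {set V}) (u v w x y : V).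

Definition subgraph G K : Prop :=
  vset G \subset vset K /\ subrel (edge G) (edge K).

Definition induced_edge G S : rel V :=
  [rel x y | [&& x \in S, y \in S & edge G x y]].

Lemma induced_sym G S : symmetric (induced_edge G S).
Proof. by move=> x y; rewrite /induced_edge /= (edge_sym G x) andbCA. Qed.

Lemma induced_irr G S : irreflexive (induced_edge G S).
Proof. by move=> x; rewrite /induced_edge /= edge_irr !andbF. Qed.

Lemma induced_vset G S x y : induced_edge G S x y -> x \in vset G :&: S.
Proof. by case/and3P=> xS _ /edge_vset xG; rewrite inE xG. Qed.

Definition induced G S : sgraph V :=
  SGraph (@induced_sym G S) (@induced_irr G S) (@induced_vset G S).

Definition component G x : sgraph V :=
  induced G [set y | connect (edge G) x y].

Definition biclique K A B : Prop :=
  [/\ A != set0, B != set0, [disjoint A & B], vset K = A :|: B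
    & forall x y, edge K x y =
        (x \in A) && (y \in B) || (x \in B) && (y \in A)].

Definition bi_equivalence G : Prop :=
  forall x, x \in vset G -> exists A B, biclique (component G x) A B.

(* The members of the family are allowed to be empty graphs. *)
Definition bi_equivalence_partition r K (G : 'I_r -> sgraph V) : Prop :=
  [/\ forall i, bi_equivalence (G i),
      forall i, subgraph (G i) K
    & forall x y, edge K x y -> exists! i, edge (G i) x y].

(* Equivalence of two vertices u, v of one class; B is the opposite class. *)
Definition equivalent r (G : 'I_r -> sgraph V) B u v : Prop :=
  forall w, w \in B -> exists i, edge (G i) u w /\ edge (G i) v w.

Definition no_two_equivalent r (G : 'I_r -> sgraph V) A B : Prop :=
  forall u v, u \in A -> v \in A -> u != v -> ~ equivalent G B u v.

End Graphs.

(* Main.v *)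
(** Fix a vertex b of B and a colour i. The vertices a of A joined to b in G_i
    all have the same neighbourhood S in G_i, so they are still pairwise
    inequivalent with respect to B \ S, where only the other r - 1 colours
    occur. By induction there are at most (r-1)! of them, and summing over the
    r colours gives |A| <= r * (r-1)!. For equality take A = S_r,
    B = {0, ..., r-1}, and give the edge between s and j the colour s(j). *)
Require Import Defs.
From mathcomp Require Import all_boot.
From mathcomp Require Import fingroup perm.
Set Implicit Arguments.
Unset Strict Implicit.
Unset Printing Implicit Defensive.

Lemma card_bigcup_le (I T : finType) (P : pred I) (F : I -> {set T}) :
  #|\bigcup_(i | P i) F i| <= \sum_(i | P i) #|F i|.
Proof.
elim/big_rec2: _ => [|i n X _ leXn]; first by rewrite cards0.
by rewrite (leq_trans (leq_card_setU _ _)) ?leq_add2l.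
Qed.

(** The induction removes a colour from [C] and shrinks both [A] and [B], so the bound is stated for
    finite sets instead of graphs. Bi-equivalence enters only as the rectangle property in the
    second hypothesis. *)
Lemma card_rows_le_fact (I S T : finType) (C : {set I}) (A : {set S})
    (B : {set T}) (c : I -> S -> T -> bool) :
  (forall a b, a \in A -> b \in B -> exists2 i, i \in C & c i a b) ->
  (forall i a a' b b', c i a b -> c i a b' -> c i a' b -> c i a' b') ->
  (forall a a', a \in A -> a' \in A ->
     (forall b, b \in B -> exists i, c i a b /\ c i a' b) -> a = a') ->
  #|A| <= #|C|`!.
Proof.
move=> + rect; move: {-1}#|C| (erefl #|C|) => n.
(* If [B] is empty, any two rows agree vacuously, so [A] has at most one element. In the base case
   with [b] in [B], a row would need a colour from the empty [C]. *)
elim: n C A B => [|n IHn] C A B cardC colored distinct;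
  (have [B0|[b bB]] := set_0Vmem B;
   first by rewrite (leq_trans _ (fact_gt0 _)) //;
     apply/card_le1_eqP => a a' aA a'A; apply: distinct => // b;
     rewrite B0 inE).
  have [->|[a aA]] := set_0Vmem A; first by rewrite cards0.
  by have [i] := colored a b aA bB; rewrite (cards0_eq cardC) inE.
pose Ai i := [set a in A | c i a b].
have /subset_leq_card leA: A \subset \bigcup_(i in C) Ai i.
  apply/subsetP => a aA; have [i iC ci] := colored a b aA bB.
  by apply/bigcupP; exists i; rewrite // inE aA.
apply: leq_trans leA (leq_trans (card_bigcup_le _ _) _).
rewrite factS -cardC -sum_nat_const; apply: leq_sum => i iC.
(* All rows of [Ai i] have colour [i] at [b], so a column where one of them has colour [i] is one
   where all do. Discarding these columns keeps the rows distinguishable. *)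
pose Bi := [set b' in B | [forall a in Ai i, ~~ c i a b']].
apply: (IHn (C :\ i) _ Bi).
- by apply/eqP; rewrite -eqSS -cardC (cardsD1 i C) iC.
- move=> a b' aAi; rewrite inE => /andP[b'B /forall_inP noti].
  have aA : a \in A by case/setIdP: aAi.
  have [j jC cj] := colored a b' aA b'B.
  exists j => //; rewrite !inE jC andbT.
  by apply: contraTneq cj => ->; apply: noti.
move=> a a' /setIdP[aA ca] /setIdP[a'A ca'] eqBi; apply: distinct => // b' b'B.
have [b'Bi|] := boolP (b' \in Bi); first exact: eqBi.
rewrite inE b'B negb_forall_in => /exists_inP[d /setIdP[_ cdb] /negbNE cdb'].
by exists i; split; apply: rect cdb cdb' _.
Qed.

Section UpperBound.
Variable V : finType.

(** All four vertices lie in one component, a biclique with [a], [a'] in one class and [b], [b'] in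
    the other. *)
Lemma bi_equivalence_rect (G : sgraph V) (a a' b b' : V) :
  bi_equivalence G ->
  edge G a b -> edge G a b' -> edge G a' b -> edge G a' b'.
Proof.
move=> biG ab ab' a'b.
have [X [Y [_ _ dXY _ eXY]]] := biG a (edge_vset ab).
have conb := connect1 ab; have conb' := connect1 ab'.
have cona' : connect (edge G) a a'.
  by apply: connect_trans conb (connect1 _); rewrite edge_sym.
have notXY z : z \in X -> z \in Y -> False.
  by move=> zX zY; rewrite (disjointFr dXY zX) in zY.
(* Each known edge runs from [X] to [Y] or from [Y] to [X]; mixed directions would put [a] or [b] in
   both classes. *)
move: (eXY a b) (eXY a b') (eXY a' b) (eXY a' b').
rewrite /= /induced_edge /= !inE connect0 conb conb' cona' ab ab' a'b /=.
move=> /esym/orP[]/andP[aX bY] /esym/orP[]/andP[aX' b'Y]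
  /esym/orP[]/andP[a'X bY'] ->;
  by [rewrite a'X b'Y ?orbT | case: (notXY a) | case: (notXY b)].
Qed.

Lemma biclique_swap (K : sgraph V) (A B : {set V}) :
  biclique K A B -> biclique K B A.
Proof.
by case=> A0 B0 dAB vK eK; split; rewrite // 1?disjoint_sym 1?setUC // => x y;
  rewrite eK orbC.
Qed.

Lemma card_class_le_fact (r : nat) (K : sgraph V) (A B : {set V})
    (G : 'I_r -> sgraph V) :
  biclique K A B -> bi_equivalence_partition K G ->
  no_two_equivalent G A B -> #|A| <= r`!.
Proof.
move=> [_ _ _ _ eK] [biG _ partG] inequiv.
rewrite -[r in r`!]card_ord -cardsT.
apply: (card_rows_le_fact (B := B) (c := fun i => edge (G i))).
- move=> a b aA bB; have [|i [ei _]] := partG a b; last by exists i.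
  by rewrite eK aA bB.
- by move=> i a a' b b'; apply: bi_equivalence_rect.
move=> a a' aA a'A eqv; apply/eqP/negPn/negP => neq.
exact: (inequiv a a').
Qed.

End UpperBound.

Section LevelGraph.
Variables (V : finType) (T : eqType) (side : V -> bool) (p : V -> T).

(** Under [opposite] below, the components are the level sets of [p], each split by [side] into its
    two blocks. *)
Definition level_edge (x y : V) : bool :=
  (side x != side y) && (p x == p y).

Lemma level_sym : symmetric level_edge.
Proof. by move=> x y; rewrite /level_edge eq_sym [p x == _]eq_sym. Qed.

Lemma level_irr : irreflexive level_edge.
Proof. by move=> x; rewrite /level_edge eqxx. Qed.

Lemma level_vset x y : level_edge x y -> x \in [set: V].
Proof. by rewrite inE. Qed.

Definition level_graph : sgraph V := SGraph level_sym level_irr level_vset.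

(** Every level set meets both sides: no block is empty, and two vertices of one level and one side
    have a common neighbour. *)
Hypothesis opposite : forall x, exists2 y, side y != side x & p y = p x.

Lemma connect_level x y : connect level_edge x y = (p x == p y).
Proof.
apply/idP/eqP => [/connectP[s]|eqp].
  by elim: s x => [|z s IHs] x /= => [_ -> //|/andP[/andP[_ /eqP->]]]; apply: IHs.
have [eqs|neqs] := eqVneq (side x) (side y); last first.
  by apply: connect1; rewrite /level_edge neqs eqp eqxx.
have [z neqs eqz] := opposite x.
apply: (connect_trans (y := z)); apply: connect1; rewrite /level_edge.
  by rewrite eq_sym neqs eqz eqxx.
by rewrite -eqs neqs eqz eqp eqxx.
Qed.

Lemma level_bi_equivalence : bi_equivalence level_graph.
Proof.
move=> x _.
pose X s := [set y | (side y == s) && (p x == p y)].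
have [z neqs eqz] := opposite x.
(* As [side] is Boolean, these two blocks exhaust the level set of [x]. *)
exists (X (side x)), (X (side z)); split.
- by apply/set0Pn; exists x; rewrite inE !eqxx.
- by apply/set0Pn; exists z; rewrite inE eqz !eqxx.
- apply/pred0P => y /=; rewrite !inE.
  by apply: contraNF neqs => /andP[/andP[/eqP<- _] /andP[/eqP<- _]].
- apply/setP => y; rewrite !inE connect_level -andb_orl.
  by move: neqs; case: (side x) (side y) (side z) => [] [] [].
move=> y w; rewrite /= /induced_edge /= /level_edge !inE !connect_level.
have [<-|] := eqVneq (p x) (p y); last by rewrite !andbF.
have [_|] := eqVneq (p x) (p w); last by rewrite !andbF.
by move: neqs; case: (side x) (side y) (side z) (side w)
  => [] [] [] [].
Qed.

End LevelGraph.

Section Extremal.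
Variable r : nat.

Let V : finType := ('S_r + 'I_r)%type.
Let side (x : V) : bool := if x is inl _ then true else false.

(* The block of colour [i] containing [x] is indexed by the position that
   the permutations in it send to [i]. *)
Let pos (i : 'I_r) (x : V) : 'I_r :=
  match x with inl s => (s^-1)%g i | inr j => j end.

(** A constant labelling has a single level, so all edges between the sides are present. *)
Definition perm_complete : sgraph V := level_graph side (fun=> tt).
Definition perm_color (i : 'I_r) : sgraph V := level_graph side (pos i).
Definition perm_vertices : {set V} := [set x | side x].
Definition pos_vertices : {set V} := [set x | ~~ side x].

Lemma card_perm_vertices : #|perm_vertices| = r`!.
Proof.
rewrite -card_Sn -(card_imset _ (@inl_inj 'S_r 'I_r)); apply: eq_card => x.
rewrite inE; case: x => [s|j] /=; first by rewrite imset_f.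
by apply/esym/imsetP => -[].
Qed.

Lemma card_pos_vertices : #|pos_vertices| = r.
Proof.
rewrite -[RHS]card_ord -(card_imset _ (@inr_inj 'S_r 'I_r)).
apply: eq_card => x; rewrite inE; case: x => [s|j] /=; last by rewrite imset_f.
by apply/esym/imsetP => -[].
Qed.

Lemma perm_color_lr i s j : edge (perm_color i) (inl s) (inr j) = (s j == i).
Proof. by rewrite /= /level_edge /= (canF_eq (permKV s)) eq_sym. Qed.

Lemma perm_biclique : 0 < r -> biclique perm_complete perm_vertices pos_vertices.
Proof.
move=> r_gt0; split.
- by rewrite -card_gt0 card_perm_vertices fact_gt0.
- by rewrite -card_gt0 card_pos_vertices.
- by apply/pred0P => x /=; rewrite !inE andbN.
- by apply/setP => x; rewrite !inE orbN.
by move=> [s|j] [t|k]; rewrite /= /level_edge !inE.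
Qed.

Lemma perm_partition : bi_equivalence_partition perm_complete perm_color.
Proof.
split.
- move=> i; apply: level_bi_equivalence => -[s|j].
    by exists (inr ((s^-1)%g i)).
  (* Any permutation sending [j] to [i] would do; the transposition is its own inverse. *)
  by exists (inl (tperm i j)); rewrite //= tpermV tpermL.
- move=> i; split=> [|x y /andP[neqs _]]; first exact: subsetT.
  by rewrite /= /level_edge neqs.
have uniq_color s j : exists! i, edge (perm_color i) (inl s) (inr j).
  exists (s j); split=> [|i]; first by rewrite perm_color_lr.
  by rewrite perm_color_lr => /eqP.
move=> [s|j] [t|k] /andP[] // _ _.
have [i [ei uniqi]] := uniq_color t j.
exists i; split=> [|i' ei']; first by rewrite edge_sym.
by apply: uniqi; rewrite edge_sym.
Qed.

Lemma perm_inequivalent :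
  no_two_equivalent perm_color perm_vertices pos_vertices.
Proof.
move=> [s|j] [t|k]; rewrite !inE // => _ _ /eqP neq eqv; apply: neq.
congr inl; apply/permP => j.
have [|i] := eqv (inr j); first by rewrite inE.
by rewrite !perm_color_lr => -[/eqP-> /eqP->].
Qed.

Lemma pos_inequivalent :
  no_two_equivalent perm_color pos_vertices perm_vertices.
Proof.
move=> [s|j] [t|k]; rewrite !inE // => _ _ /eqP neq eqv; apply: neq.
(* The edge from the identity to [j] has colour [j], so this one vertex separates all positions. *)
have [|i [/andP[_ /eqP/= ->] /andP[_ /eqP/= ->]] //] := eqv (inl 1%g).
by rewrite inE.
Qed.

End Extremal.

(** Inequivalence in [A] alone does not bound the size of [B]: a star centred at the only vertex of
    [A] is one bi-equivalence graph with [B] of any size. Hence the bound on the maximum also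
    assumes inequivalence in [B]. For [r = 0] the edges of a biclique have no colour, so equality is
    asked for [0 < r]. *)
Theorem theorem2 :
  (forall (V : finType) (r : nat) (K : sgraph V) (A B : {set V})
          (G : 'I_r -> sgraph V),
      biclique K A B ->
      bi_equivalence_partition K G ->
      no_two_equivalent G A B ->
      #|A| <= r`! /\
      (no_two_equivalent G B A -> maxn #|A| #|B| <= r`!))
  /\
  (forall r : nat, 0 < r ->
    exists (V : finType) (K : sgraph V) (A B : {set V})
           (G : 'I_r -> sgraph V),
      [/\ biclique K A B,
          bi_equivalence_partition K G,
          no_two_equivalent G A B,
          no_two_equivalent G B A
        & maxn #|A| #|B| = r`!]).
Proof.
split=> [V r K A B G bK pG ineqA | r r_gt0].
  have leA := card_class_le_fact bK pG ineqA.
  split=> // ineqB; rewrite geq_max leA.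
  exact: card_class_le_fact (biclique_swap bK) pG ineqB.
exists ('S_r + 'I_r)%type, (perm_complete r), (perm_vertices r),
  (pos_vertices r), (@perm_color r); split.
- exact: perm_biclique.
- exact: perm_partition.
- exact: perm_inequivalent.
- exact: pos_inequivalent.
by rewrite card_perm_vertices card_pos_vertices; apply/maxn_idPl/fact_geq.
Qed.
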